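(* Let $I,J\subset\mathbb{Z}^d$ be finite sets with $|I|=|J|$ and $I\cap J=\emptyset$, let $A(I,J)=\prod_{i\in I}A_i\prod_{j\in J}A_j^*$, and let $$\mathcal{E}_{I,J}(f)=\sum_{k\in\mathbb{Z}^d}\|\delta_{A(I+k,J+k)}f\|_{2,\omega_0}^2$$ for all $f$ for which the right-hand side is finite. Then the Dirichlet form $\mathcal{E}_{I,J}$ does not satisfy the Poincaré inequality, i.e. it has no spectral gap: there is no constant $m\in(0,\infty)$ such that $m\|f-\omega_0(f)\|_{2,\omega_0}^2\le\mathcal{E}_{I,J}(f)$ for all $f$ in the domain of $\mathcal{E}_{I,J}$.
   Context: $\{A_j,A_j^*\}_{j\in\mathbb{Z}^d}$ are mutually commuting copies of annihilation and creation operators: $[A_j,A_j^*]=\mathrm{id}$, $[A_j,A_k]=[A_j,A_k^*]=0$ for $j\neq k$; each copy acts on a Hilbert space with orthonormal basis $(e_n)_{n\ge0}$ by $Ae_n=\sqrt n\,e_{n-1}$, $A^*e_n=\sqrt{n+1}\,e_{n+1}$. $N_j=A_j^*A_j$. For $\beta\in(0,\infty)$, $\omega_0$ is the infinite product state: for $f$ localised in a finite set $\Lambda$, $\omega_0(f)=\mathrm{Tr}_\Lambda(\rho_\Lambda f)$ with $\rho_\Lambda=\bigotimes_{j\in\Lambda}\frac{1}{Z_0}e^{-\beta N_j}$, $Z_0=\mathrm{Tr}\,e^{-\beta N_j}$. The scalar product is $\langle f,g\rangle_{\omega_0}=\lim_{\Lambda\to\mathbb{Z}^d}\mathrm{Tr}_\Lambda(\rho_\Lambda^{1/2}f^*\rho_\Lambda^{1/2}g)$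 with norm $\|\cdot\|_{2,\omega_0}$, and $\mathbb{L}_2(\omega_0)$ is the completion. $\delta_X(f)=i[X,f]$. $I+k$, $J+k$ are the translates by $k\in\mathbb{Z}^d$. The domain of $\mathcal{E}_{I,J}$ contains all local polynomials in creation and annihilation operators. *)

(* Defs.v *)
From HB Require Import structures.
From mathcomp Require Import all_boot all_order all_algebra finmap.
From mathcomp Require Import all_classical all_reals all_analysis.
From mathcomp Require Import complex.
From mathcomp Require Import showcase.summability.

Set Implicit Arguments.
Unset Strict Implicit.
Unset Printing Implicit Defensive.

Import Order.TTheory GRing.Theory Num.Theory numFieldNormedType.Exports.

Local Open Scope classical_set_scope.
Local Open Scope ring_scope.
Local Open Scope complex_scope.

Notation site d := 'rV[int]_d (only parsing).

(* An occupation configuration n, i.e. the index of the product basis vector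
   e_n = \bigotimes_j e_(n j); all but finitely many sites are in the state
   e_0. *)
Notation config d := {fsfun site d -> nat with 0%N} (only parsing).

(* Operators are given by their matrix elements X n m = <e_n, X e_m>.  An
   observable localised in Lambda is identified with its tensor product with
   the identity outside Lambda. *)
Notation op R d := (config d -> config d -> R[i]) (only parsing).

Section Operators.
Variables (R : realType) (d : nat).

(* The rows and columns of a polynomial in the A_j, A_j^* have finite support,
   so that the sum over k is finite for all products of such operators and
   diagonal ones. *)
Definition mulop (X Y : op R d) : op R d :=
  fun n m => \sum_(k \in [set: config d]) X n k * Y k m.

Definition diagop (w : config d -> R) : op R d :=
  fun n m => if n == m then (w n)%:C else 0.

Definition oneop : op R d := diagop (fun=> 1).

Definition adjop (X : op R d) : op R d := fun n m => (X m n)^*.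

(* A_j e_m = sqrt (m j) e_(m - delta_j) *)
Definition annihilation (j : site d) : op R d := fun n m =>
  if m == [fsfun n with j |-> (n j).+1] then (Num.sqrt (m j)%:R)%:C else 0.

(* A_j^* e_m = sqrt (m j + 1) e_(m + delta_j) *)
Definition creation (j : site d) : op R d := fun n m =>
  if n == [fsfun m with j |-> (m j).+1] then (Num.sqrt (m j).+1%:R)%:C else 0.

Inductive local_poly : op R d -> Prop :=
| local_poly_one : local_poly oneop
| local_poly_annihilation j : local_poly (annihilation j)
| local_poly_creation j : local_poly (creation j)
| local_poly_add f g : local_poly f -> local_poly g -> local_poly (f + g)
| local_poly_scale (c : R[i]) f : local_poly f -> local_poly (c *: f)
| local_poly_mul f g : local_poly f -> local_poly g -> local_poly (mulop f g).

(* The order of the factors within each product is immaterial, since creation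
   operators commute with each other, and so do annihilation operators. *)
Definition prodA (I J : {fset site d}) : op R d :=
  mulop (\big[mulop/oneop]_(i <- I) annihilation i)
        (\big[mulop/oneop]_(j <- J) creation j).

Definition translate (I : {fset site d}) (k : site d) : {fset site d} :=
  [fset (i + k)%R | i in I]%fset.

Definition delta (X f : op R d) : op R d := 'i *: (mulop X f - mulop f X).

(* For X localised in L this is the trace over \bigotimes_(j in L) H_j: the
   configurations supported in L index the basis of that space. *)
Definition trace (L : {fset site d}) (X : op R d) : R[i] :=
  sum (fun n : config d =>
    (if (finsupp n `<=` L)%fset then X n n else 0) : R[i]^o).

(* Limit along the finite subsets of Z^d, directed by inclusion. *)
Definition thermolim (u : {fset site d} -> R[i]) : R[i] :=
  lim ((u : {fset site d} -> R[i]^o) @ totally).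

End Operators.
Arguments oneop {R d}.

Section ProductState.
Variables (R : realType) (d : nat) (beta : R).

Definition Z0 : R := limn (series (fun n : nat => expR (- (beta * n%:R)))).

Definition weight (L : {fset site d}) (n : config d) : R :=
  \prod_(j <- L) (Z0^-1 * expR (- (beta * (n j)%:R))).

(* rho_L ^ s; the density matrix rho_L is the case s = 1. *)
Definition rho (s : R) (L : {fset site d}) : op R d :=
  diagop (fun n => weight L n `^ s).

Definition state (f : op R d) : R[i] :=
  thermolim (fun L => trace L (mulop (rho 1 L) f)).

Definition inner2 (f g : op R d) : R[i] :=
  thermolim (fun L => trace L
    (mulop (rho 2^-1 L) (mulop (adjop f) (mulop (rho 2^-1 L) g)))).

Definition norm2 (f : op R d) : R := Num.sqrt (complex.Re (inner2 f f)).

(* The completion of the local polynomials for norm2: its elements are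
   represented by Cauchy sequences, two of which represent the same element
   when the norm of their difference tends to 0.  All the notions below are
   invariant under this equivalence. *)
Record L2 : Type := MkL2 {
  L2seq :> nat -> op R d ;
  L2_local_poly : forall n, local_poly (L2seq n) ;
  L2_cauchy : forall e : R, 0 < e -> exists N : nat, forall p q : nat,
    (N <= p)%N -> (N <= q)%N -> norm2 (L2seq p - L2seq q) < e }.

Definition normL2 (f : L2) : R := limn (fun n => norm2 (f n)).

Definition eqL2 (f g : L2) : Prop := norm2 (f n - g n) @[n --> \oo] --> 0.

Definition stateL2 (f : L2) : R[i] := limn (fun n => state (f n) : R[i]^o).

Definition center_seq (f : L2) (n : nat) : op R d :=
  f n + (- stateL2 f) *: oneop.

Lemma center_local_poly (f : L2) n : local_poly (center_seq f n).
Proof.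
apply: local_poly_add; first exact: L2_local_poly.
by apply: local_poly_scale; exact: local_poly_one.
Qed.

Lemma center_cauchy (f : L2) (e : R) : 0 < e -> exists N : nat,
  forall p q : nat, (N <= p)%N -> (N <= q)%N ->
    norm2 (center_seq f p - center_seq f q) < e.
Proof.
move=> /(L2_cauchy f)[N hN]; exists N => p q hp hq.
by rewrite /center_seq opprD addrACA subrr addr0; exact: hN.
Qed.

(* f - omega_0(f) *)
Definition centered (f : L2) : L2 :=
  MkL2 (center_local_poly f) (center_cauchy f).

(* The graph of delta X on the completion, that is, of the closure of the
   commutator with X defined on the local polynomials. *)
Definition is_delta (X : op R d) (f g : L2) : Prop :=
  exists h : L2, eqL2 h f /\ norm2 (delta X (h n) - g n) @[n --> \oo] --> 0.

(* The square norm of delta X f, and +oo when f is not in the domain of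
   delta X; delta X is closable, so at most one value enters the infimum. *)
Definition delta_norm_sq (X : op R d) (f : L2) : \bar R :=
  ereal_inf [set (normL2 g ^+ 2)%:E | g in [set g | is_delta X f g]].

Definition dirichlet (I J : {fset site d}) (f : L2) : \bar R :=
  \esum_(k in [set: site d])
    delta_norm_sq (prodA R (translate I k) (translate J k)) f.

End ProductState.

(* Main.v *)
(**
Test the inequality on the number operator [N = \sum_(j in Lam) A_j^* A_j] of a
large cube [Lam].  Since [|I| = |J|], the operator [A(I+k, J+k)] preserves the
number of particles as soon as [I+k] and [J+k] are both inside, or both outside,
[Lam]; it therefore commutes with [N] except for the [k] close to the boundary
of [Lam].  For those [k] the commutator is a bounded multiple of
[A(I+k, J+k)], whose norm does not depend on [k] by translation invariance.
Hence the Dirichlet form of [N] is at most of the order of the boundary of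
[Lam], while [|N - z|^2] is for every scalar [z] at least the variance of a sum of
[|Lam|] independent geometric variables, which is of the order of [|Lam|].
*)
Require Import Defs.
From HB Require Import structures.
From mathcomp Require Import all_boot all_order all_algebra finmap.
From mathcomp Require Import all_classical all_reals all_analysis.
From mathcomp Require Import complex ring zify.
From mathcomp Require Import showcase.summability.

Set Implicit Arguments.
Unset Strict Implicit.
Unset Printing Implicit Defensive.

Import Order.TTheory GRing.Theory Num.Theory numFieldNormedType.Exports.

Local Open Scope classical_set_scope.
Local Open Scope ring_scope.
Local Open Scope complex_scope.

Local Notation site d := 'rV[int]_d (only parsing).
Local Notation config d := {fsfun site d -> nat with 0%N} (only parsing).
Local Notation op R d := (config d -> config d -> R[i]) (only parsing).

#[local] Existing Instance totally_filter.

(** * Commutators with the number operator *)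

Section OperatorAlgebra.
Variables (R : realType) (d : nat).
Implicit Types (X Y : op R d) (n m : config d) (j : site d).

Lemma fsum_single (T : choiceType) (V : nmodType) (x : T) (F : T -> V) :
  (forall k, k != x -> F k = 0) -> \sum_(k \in [set: T]) F k = F x.
Proof.
move=> F0; rewrite (fsbigTE [fset x]%fset) ?big_seq_fset1// => k.
by rewrite inE; exact: F0.
Qed.

(** The entries are complex, unlike those of [diagop], because the number operator will be shifted
    by an arbitrary complex scalar. *)
Definition cdiagop (w : config d -> R[i]) : op R d :=
  fun n m => if n == m then w n else 0.

Lemma diagopE (w : config d -> R) : diagop w = cdiagop (fun n => (w n)%:C).
Proof. by []. Qed.

Lemma mul_diagop (w : config d -> R[i]) X n m :
  mulop (cdiagop w) X n m = w n * X n m.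
Proof.
rewrite /mulop (@fsum_single _ _ n); first by rewrite /cdiagop eqxx.
by move=> k; rewrite /cdiagop eq_sym => /negbTE ->; rewrite mul0r.
Qed.

Lemma mulop_diag (w : config d -> R[i]) X n m :
  mulop X (cdiagop w) n m = X n m * w m.
Proof.
rewrite /mulop (@fsum_single _ _ m); first by rewrite /cdiagop eqxx.
by move=> k; rewrite /cdiagop => /negbTE ->; rewrite mulr0.
Qed.

(** A sum with infinite support takes the default value 0, so a nonzero entry of a product always
    comes from a nonzero term. Particle balances can thus be composed without discussing
    finiteness. *)
Lemma mulop_neq0 X Y n m :
  mulop X Y n m != 0 -> exists k, X n k != 0 /\ Y k m != 0.
Proof.
rewrite /mulop => nz.
have [k _] := @fsbigN1 _ _ _ _ _ _ (fun n k => X n k * Y k m) n nz.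
by rewrite mulf_eq0 negb_or => /andP[? ?]; exists k.
Qed.

Lemma local_poly_mul_seq (T : Type) (s : seq T) (F : T -> op R d) :
  (forall x, local_poly (F x)) ->
  local_poly (\big[@mulop R d/oneop]_(x <- s) F x).
Proof.
move=> lF; elim: s => [|x s ih]; first by rewrite big_nil; exact: local_poly_one.
by rewrite big_cons; exact: local_poly_mul.
Qed.

Lemma local_poly_prodA I J : local_poly (@prodA R d I J).
Proof.
apply: local_poly_mul; apply: local_poly_mul_seq => j.
- exact: local_poly_annihilation.
- exact: local_poly_creation.
Qed.

Lemma local_poly_zero : local_poly (0 : op R d).
Proof.
have := local_poly_scale (0 : R[i]) (@local_poly_one R d).
by rewrite scale0r.
Qed.

Lemma local_poly_delta X Y :
  local_poly X -> local_poly Y -> local_poly (delta X Y).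
Proof.
move=> lX lY; apply: local_poly_scale; apply: local_poly_add.
  exact: local_poly_mul.
rewrite -scaleN1r; apply: local_poly_scale; exact: local_poly_mul.
Qed.

Definition numop (Lam : {fset site d}) : op R d :=
  \sum_(j <- Lam) mulop (creation R j) (annihilation R j).

Lemma local_poly_numop Lam : local_poly (numop Lam).
Proof.
rewrite /numop; elim: (Lam : seq _) => [|j s ih].
  by rewrite big_nil; exact: local_poly_zero.
rewrite big_cons; apply: local_poly_add => //; apply: local_poly_mul.
- exact: local_poly_creation.
- exact: local_poly_annihilation.
Qed.

Definition occ (s : seq (site d)) n : nat := (\sum_(j <- s) n j)%N.

Lemma with_succ_inj j n m :
  [fsfun n with j |-> (n j).+1] = [fsfun m with j |-> (m j).+1] -> n = m.
Proof.
move=> e; apply/fsfunP => x; have := congr1 (fun f : config d => f x) e.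
by rewrite !fsfun_withE; case: eqP => // -> [].
Qed.

(** Only one intermediate configuration contributes, with one particle fewer at [j] than [n], and
    none does when [n j] is 0. The two square roots then multiply to [n j]. *)
Lemma creation_annihilationE j :
  mulop (creation R j) (annihilation R j) = cdiagop (fun n => (n j)%:R).
Proof.
apply/funext => n; apply/funext => m.
have [nj0|nj0] := eqVneq (n j) 0%N.
  rewrite /mulop fsbig1 => [|k _]; last first.
    rewrite /creation; case: eqP => [e|]; last by rewrite mul0r.
    by move: nj0; rewrite e fsfun_with.
  by rewrite /cdiagop nj0; case: ifP.
pose k : config d := [fsfun n with j |-> (n j).-1].
have kn : [fsfun k with j |-> (k j).+1] = n.
  apply/fsfunP => x; rewrite /k !fsfun_withE eqxx.
  by case: eqP => // ->; rewrite prednK// lt0n.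
rewrite /mulop (@fsum_single _ _ k); last first.
  move=> k'; rewrite /creation => kk'.
  case: eqP => [e|]; last by rewrite mul0r.
  by move: kk'; rewrite (@with_succ_inj j k' k) ?eqxx// -e kn.
rewrite /creation /annihilation /cdiagop kn eqxx.
rewrite [m == n]eq_sym; case: eqP => [<-|]; last by rewrite mulr0.
rewrite /k fsfun_with prednK ?lt0n// -rmorphM -expr2 sqr_sqrtr ?ler0n//.
by rewrite rmorph_nat.
Qed.

Lemma numopE Lam : numop Lam = cdiagop (fun n => (occ Lam n)%:R).
Proof.
rewrite /numop /occ; elim: (Lam : seq _) => [|j s ih].
  rewrite big_nil; apply/funext => n; apply/funext => m.
  by rewrite /cdiagop big_nil; case: ifP.
rewrite big_cons ih creation_annihilationE.
apply/funext => n; apply/funext => m; rewrite /cdiagop !fctE big_cons natrD.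
by case: ifP => // _; rewrite addr0.
Qed.

(* [X] removes [a] particles from [Lam] and adds [b]: recall that [X n m] is the
   coefficient of [e_n] in [X e_m]. *)
Definition shifts_occ (Lam : {fset site d}) X (a b : nat) :=
  forall n m, X n m != 0 -> (occ Lam m + b = occ Lam n + a)%N.

(** Since [numop Lam] is diagonal, the commutator multiplies the entry [X n m] by
    [occ Lam m - occ Lam n], which the particle balance fixes at [a - b] wherever that entry is
    nonzero. *)
Lemma delta_numop Lam X a b : shifts_occ Lam X a b ->
  delta X (numop Lam) = ('i * (a%:R - b%:R)) *: X.
Proof.
move=> ch; apply/funext => n; apply/funext => m.
rewrite /delta numopE.
rewrite [LHS](_ : _ = 'i * (mulop X (cdiagop (fun n => (occ Lam n)%:R)) n m -
  mulop (cdiagop (fun n => (occ Lam n)%:R)) X n m))//.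
rewrite [RHS](_ : _ = 'i * (a%:R - b%:R) * X n m)//.
rewrite mulop_diag mul_diagop -mulrA; congr (_ * _).
have [->|/ch e] := eqVneq (X n m) 0; first by rewrite !(mul0r, mulr0) subrr.
rewrite [X n m * _]mulrC -mulrBl; congr (_ * _).
apply/eqP; rewrite subr_eq addrAC eq_sym subr_eq -!natrD; apply/eqP; congr (_%:R).
by rewrite e addnC.
Qed.

Lemma shifts_occ_mul Lam X Y a b a' b' :
  shifts_occ Lam X a b -> shifts_occ Lam Y a' b' ->
  shifts_occ Lam (mulop X Y) (a + a') (b + b').
Proof.
move=> hX hY n m /mulop_neq0[k [/hX h1 /hY h2]].
by rewrite [(b + b')%N]addnC addnA h2 addnAC h1 addnA.
Qed.

Lemma shifts_occ_one Lam : shifts_occ Lam oneop 0 0.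
Proof.
move=> n m; rewrite /oneop /diagop; case: (n =P m) => [->//|_]; by rewrite eqxx.
Qed.

Lemma occ_with_succ (Lam : {fset site d}) j n :
  occ Lam [fsfun n with j |-> (n j).+1] = (occ Lam n + (j \in Lam))%N.
Proof.
rewrite /occ; have [jL|jL] := boolP (j \in Lam).
  rewrite !(big_fsetD1 j jL)/= fsfun_with [RHS]addnC addnA add1n.
  congr (_ + _)%N; apply: eq_big_seq => x; rewrite !inE => /andP[xj _].
  by rewrite fsfun_withE (negbTE xj).
rewrite addn0; apply: eq_big_seq => x xL; rewrite fsfun_withE.
by case: eqP => // e; move: jL; rewrite -e xL.
Qed.

Lemma shifts_occ_annihilation (Lam : {fset site d}) j :
  shifts_occ Lam (annihilation R j) (j \in Lam) 0.
Proof.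
move=> n m; rewrite /annihilation; case: (m =P _) => [->|_]; last by rewrite eqxx.
by rewrite occ_with_succ addn0.
Qed.

Lemma shifts_occ_creation (Lam : {fset site d}) j :
  shifts_occ Lam (creation R j) 0 (j \in Lam).
Proof.
move=> n m; rewrite /creation; case: (n =P _) => [->|_]; last by rewrite eqxx.
by rewrite occ_with_succ addn0.
Qed.

Lemma shifts_occ_prodA (Lam I J : {fset site d}) :
  shifts_occ Lam (prodA R I J) (count [in Lam] I) (count [in Lam] J).
Proof.
rewrite -[count _ I]addn0 -[count _ J]add0n /prodA; apply: shifts_occ_mul.
  elim: (I : seq _) => [|j s ih]; first by rewrite big_nil; exact: shifts_occ_one.
  rewrite big_cons; exact: (shifts_occ_mul (@shifts_occ_annihilation _ _) ih).
elim: (J : seq _) => [|j s ih]; first by rewrite big_nil; exact: shifts_occ_one.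
rewrite big_cons; exact: (shifts_occ_mul (@shifts_occ_creation _ _) ih).
Qed.

End OperatorAlgebra.

(** * Translation invariance *)

Lemma partial_sumE (I : choiceType) (V : zmodType) (x : I -> V) (A : {fset I}) :
  partial_sum x A = \sum_(i <- A) x i.
Proof. by rewrite /partial_sum [RHS]big_seq_fsetE. Qed.

(* Equality of the image filters gives equality of the [lim]s, whether or not
   these exist; no convergence has to be proved for translation invariance. *)
Section TotallyReindex.
Variables (I J : choiceType) (f : I -> J) (g : J -> I).
Hypotheses (fK : cancel f g) (gK : cancel g f).

Lemma fmap_totally_imfset (T : Type) (u : {fset J} -> T) :
  (fun A : {fset I} => u [fset f x | x in A]%fset) @ totally = u @ totally.
Proof.
apply/seteqP; split=> P [A _ AP].
  exists [fset f x | x in A]%fset => // B /= AB.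
  (* Every finite set containing the image of [A] is itself an image, namely of its preimage, and
     that preimage contains [A]. *)
  have -> : B = [fset f x | x in [fset g y | y in B]]%fset.
    apply/fsetP => y; apply/idP/imfsetP => /= [yB|[x /imfsetP[z zB ->] ->]].
      by exists (g y); rewrite ?gK//; apply: in_imfset.
    by rewrite gK.
  apply: AP => /=; apply/fsubsetP => x xA.
  by apply/imfsetP; exists (f x); rewrite ?fK//; apply: (fsubsetP AB); apply: in_imfset.
exists [fset g x | x in A]%fset => // B /= AB; apply: AP => /=.
apply/fsubsetP => y yA; apply/imfsetP; exists (g y); rewrite ?gK//.
by apply: (fsubsetP AB); apply: in_imfset.
Qed.

Lemma sum_reindex {K : numDomainType} {V : normedModType K} (x : J -> V) :
  sum (x \o f) = sum x.
Proof.
rewrite /sum -(fmap_totally_imfset (partial_sum x)); congr (lim _).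
apply: (congr1 (fun v => v @ totally)); apply/funext => A.
rewrite !partial_sumE big_imfset//.
by move=> ? ? _ _; exact: (can_inj fK).
Qed.

End TotallyReindex.

Section Translation.
Variables (R : realType) (d : nat) (k : site d).
Implicit Types (X Y : op R d) (n m : config d) (j : site d).

Definition shift_config n : config d :=
  [fsfun j in translate (finsupp n) k => n (j - k)].

Lemma mem_translate (s : {fset site d}) j : (j \in translate s k) = (j - k \in s).
Proof.
apply/imfsetP/idP => /= [[i si ->]|sj]; first by rewrite addrK.
by exists (j - k); rewrite ?subrK.
Qed.

Lemma shift_configE n j : shift_config n j = n (j - k).
Proof.
by rewrite fsfunE mem_translate; case: (finsuppP n (j - k)).
Qed.

Definition unshift_config n : config d :=
  [fsfun j in [fset j - k | j in finsupp n]%fset => n (j + k)].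

Lemma unshift_configE n j : unshift_config n j = n (j + k).
Proof.
rewrite fsfunE; case: imfsetP => [//|h]; rewrite fsfun_dflt//.
by apply/negP => h'; apply: h; exists (j + k); rewrite ?addrK.
Qed.

Lemma shift_configK : cancel shift_config unshift_config.
Proof.
by move=> n; apply/fsfunP => j; rewrite unshift_configE shift_configE addrK.
Qed.

Lemma unshift_configK : cancel unshift_config shift_config.
Proof.
by move=> n; apply/fsfunP => j; rewrite shift_configE unshift_configE subrK.
Qed.

Lemma shift_config_bij : bijective shift_config.
Proof. by exists unshift_config; [exact: shift_configK|exact: unshift_configK]. Qed.

Lemma finsupp_shift_config n : finsupp (shift_config n) = translate (finsupp n) k.
Proof. by apply/fsetP => j; rewrite mem_translate !mem_finsupp shift_configE. Qed.

Lemma shift_config_with j n a :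
  shift_config [fsfun n with j |-> a] = [fsfun shift_config n with j + k |-> a].
Proof.
apply/fsfunP => x; rewrite shift_configE !fsfun_withE shift_configE.
by rewrite subr_eq.
Qed.

(** [X'] is the conjugate of [X] by the unitary that translates configurations by [k]. As a
    relation, this can be checked factor by factor. *)
Definition equivar X' X :=
  forall n m, X' (shift_config n) (shift_config m) = X n m.

Lemma equivar_mul X' X Y' Y :
  equivar X' X -> equivar Y' Y -> equivar (mulop X' Y') (mulop X Y).
Proof.
move=> hX hY n m; rewrite /mulop (reindex_fsbigT shift_config)//=.
  by apply: eq_fsbigr => p _; rewrite hX hY.
exact: shift_config_bij.
Qed.

Lemma equivar_adj X' X : equivar X' X -> equivar (adjop X') (adjop X).
Proof. by move=> h n m; rewrite /adjop h. Qed.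

Lemma equivar_scale c X' X : equivar X' X -> equivar (c *: X') (c *: X).
Proof. by move=> h n m; rewrite -[RHS]/(c * _) -h. Qed.

Lemma equivar_diag (w' w : config d -> R) :
  (forall n, w' (shift_config n) = w n) -> equivar (diagop w') (diagop w).
Proof.
by move=> h n m; rewrite /diagop (can_eq shift_configK) h.
Qed.

Lemma equivar_annihilation j :
  equivar (annihilation R (j + k)) (annihilation R j).
Proof.
move=> n m; rewrite /annihilation !shift_configE !addrK.
by rewrite -shift_config_with (can_eq shift_configK).
Qed.

Lemma equivar_creation j :
  equivar (creation R (j + k)) (creation R j).
Proof.
move=> n m; rewrite /creation !shift_configE !addrK.
by rewrite -shift_config_with (can_eq shift_configK).
Qed.

Lemma equivar_prod (F : site d -> op R d) (s : seq (site d)) :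
  (forall j, equivar (F (j + k)) (F j)) ->
  equivar (\big[@mulop R d/oneop]_(j <- [seq j + k | j <- s]) F j)
          (\big[@mulop R d/oneop]_(j <- s) F j).
Proof.
move=> hF; elim: s => [|j s ih] /=; rewrite ?big_nil ?big_cons.
  exact: equivar_diag.
exact: equivar_mul.
Qed.

Lemma weight_translate beta L n :
  @weight R d beta (translate L k) (shift_config n) = weight beta L n.
Proof.
rewrite /weight /translate big_imfset/=; last by move=> ? ? _ _; exact: addIr.
by apply: eq_bigr => j _; rewrite shift_configE addrK.
Qed.

Lemma trace_translate L X' X : equivar X' X ->
  trace (translate L k) X' = trace L X.
Proof.
move=> h; rewrite /trace -(sum_reindex shift_configK unshift_configK).
apply: (congr1 (fun v : config d -> (R[i])^o => sum v)).
apply/funext => n /=; rewrite h finsupp_shift_config.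
congr (if _ then _ else _); apply/fsubsetP/fsubsetP => sub j.
  move=> jn; have /sub : j + k \in translate (finsupp n) k.
    by rewrite mem_translate addrK.
  by rewrite mem_translate addrK.
by rewrite !mem_translate => /sub.
Qed.

(** The finite volumes are translated along with the configurations: the density on [translate L k]
    is the conjugate of the one on [L], so the traces agree volume by volume, and relabelling the
    volumes leaves the limit unchanged. *)
Lemma inner2_equivar beta X' X Y' Y : equivar X' X -> equivar Y' Y ->
  inner2 beta X' Y' = inner2 beta X Y.
Proof.
move=> hX hY; rewrite /inner2 /thermolim.
rewrite -(@fmap_totally_imfset _ _ (+%R^~ k) (+%R^~ (- k)) (addrK k) (subrK k)).
apply: (congr1 (fun v : {fset site d} -> (R[i])^o => lim (v @ totally))).
apply/funext => L; rewrite -/(translate L k); apply: trace_translate.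
have hrho : equivar (rho beta 2^-1 (translate L k)) (rho beta 2^-1 L).
  by apply: equivar_diag => n; rewrite weight_translate.
by do !apply: equivar_mul => //; exact: equivar_adj.
Qed.

Lemma norm2_equivar beta X' X : equivar X' X -> norm2 beta X' = norm2 beta X.
Proof. by move=> h; rewrite /norm2 (inner2_equivar beta h h). Qed.

End Translation.

(** * A bound uniform over all translates *)

Lemma ler_sum_mem (R : numDomainType) (T : eqType) (s : seq T) (F : T -> R) x :
  x \in s -> (forall y, 0 <= F y) -> F x <= \sum_(y <- s) F y.
Proof.
move=> xs F0; rewrite (big_rem x)//= lerDl; exact: sumr_ge0.
Qed.

Section PermutedProducts.
Variables (R : realType) (d : nat).
Implicit Types (I J : {fset site d}).

(* [prodA] multiplies in the order of the enumerations of [I] and [J], and the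
   enumeration of [translate I k] need not be the translated enumeration. *)
Definition prodA_seq (s t : seq (site d)) : op R d :=
  mulop (\big[@mulop R d/oneop]_(i <- s) annihilation R i)
        (\big[@mulop R d/oneop]_(j <- t) creation R j).

Lemma translate_perm k I : exists2 s : seq (site d),
  s \in permutations I & translate I k = [seq i + k | i <- s] :> seq _.
Proof.
exists [seq i - k | i <- translate I k].
  rewrite mem_permutations; apply: uniq_perm; rewrite ?fset_uniq//.
    by rewrite map_inj_uniq ?fset_uniq//; exact: (@addIr _ (- k)).
  move=> j; apply/mapP/idP => [[x]|jI].
    by rewrite mem_translate => ? ->.
  by exists (j + k); rewrite ?addrK// mem_translate addrK.
rewrite -map_comp map_id_in// => i _ /=; exact: subrK.
Qed.

(** Translating back by [k] leaves the factors of [I] and [J] in some order. There are finitely many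
    orders, so a bound uniform in [k] follows without rearranging the factors. *)
Lemma norm2_prodA_translate beta I J k (c : R[i]) : exists s t,
  [/\ s \in permutations I, t \in permutations J &
  norm2 beta (c *: prodA R (translate I k) (translate J k)) =
  norm2 beta (c *: prodA_seq s t)].
Proof.
have [s sI es] := translate_perm k I; have [t tJ et] := translate_perm k J.
exists s, t; split; [exact: sI|exact: tJ|].
apply: (norm2_equivar beta (k := k)).
apply: equivar_scale; rewrite /prodA es et; apply: equivar_mul.
- by apply: equivar_prod => j; exact: equivar_annihilation.
- by apply: equivar_prod => j; exact: equivar_creation.
Qed.

(** By translation only finitely many values occur: one for each ordering of [I] and [J] and each
    pair of counts up to [r]. The constant is the sum of all of them. *)
Lemma norm2_commutator_bounded beta I J (r : nat) : exists C : R, 0 <= C /\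
  forall k (a b : nat), (a <= r)%N -> (b <= r)%N ->
  norm2 beta (('i * (a%:R - b%:R)) *: prodA R (translate I k) (translate J k)) ^+ 2
    <= C.
Proof.
pose F (s t : seq (site d)) (a b : 'I_r.+1) : R :=
  norm2 beta (('i * ((a : nat)%:R - (b : nat)%:R)) *: prodA_seq s t) ^+ 2.
have F0 s t a b : 0 <= F s t a b by exact: sqr_ge0.
exists (\sum_(s <- permutations I) \sum_(t <- permutations J)
  \sum_(a < r.+1) \sum_(b < r.+1) F s t a b); split.
  by do !(apply: sumr_ge0 => ? _).
move=> k a b ar br.
have [s [t [sI tJ ->]]] := norm2_prodA_translate beta I J k ('i * (a%:R - b%:R)).
apply: le_trans (ler_sum_mem sI _); last first.
  by move=> ?; do !(apply: sumr_ge0 => ? _).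
apply: le_trans (ler_sum_mem tJ _); last by move=> ?; do !(apply: sumr_ge0 => ? _).
apply: le_trans (ler_sum_mem (mem_index_enum (inord a)) _); last first.
  by move=> ?; do !(apply: sumr_ge0 => ? _).
apply: le_trans (ler_sum_mem (mem_index_enum (inord b)) _); last by move=> ?.
by rewrite /F !inordK.
Qed.

End PermutedProducts.

(** * One-site Gibbs weights *)

Section OneSite.
Variable R : realType.

Lemma esum_series (u : nat -> R) (l : R) : (forall n, 0 <= u n) ->
  series u @ \oo --> l -> \esum_(n in [set: nat]) (u n)%:E = l%:E.
Proof.
move=> u0 ul; rewrite -nneseries_esumT => [|n]; last by rewrite lee_fin.
rewrite (_ : (fun n => _) = EFin \o series u); last first.
  by apply/funext => n; rewrite /= /series /= sumEFin.
by rewrite EFin_lim; [congr (_%:E); exact: cvg_lim|apply/cvg_ex; exists l].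
Qed.

Lemma series_ge_partial (u : nat -> R) (l : R) N : (forall n, 0 <= u n) ->
  series u @ \oo --> l -> series u N <= l.
Proof.
move=> u0 ul; rewrite -(cvg_lim _ ul)//; apply: nondecreasing_cvgn_le.
  by apply/nondecreasing_series => n _ _; exact: u0.
by apply/cvg_ex; exists l.
Qed.

(** Expanding the square leaves the moments of order 0, 1 and 2; the limit is written as variance
    plus squared bias. *)
Lemma series_quadratic (w : nat -> R) (m1 m2 c e a B : R) :
  series w @ \oo --> (1 : R) ->
  series (fun n => w n * n%:R) @ \oo --> m1 ->
  series (fun n => w n * n%:R ^+ 2) @ \oo --> m2 ->
  series (fun n => c * w n * ((a - e * n%:R) ^+ 2 + B)) @ \oo -->
    c * (e ^+ 2 * (m2 - m1 ^+ 2) + (a - e * m1) ^+ 2 + B).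
Proof.
move=> c0 c1 c2.
rewrite (_ : series _ = (fun N => c * (a ^+ 2 + B) * series w N
    - c * (2 * a * e) * series (fun n => w n * n%:R) N
    + c * e ^+ 2 * series (fun n => w n * n%:R ^+ 2) N)); last first.
  apply/funext => N; rewrite /series/= !mulr_sumr -sumrB -big_split/=.
  by apply: eq_bigr => n _; ring.
rewrite (_ : c * (_ + _ + B) = c * (a ^+ 2 + B) * 1 - c * (2 * a * e) * m1
    + c * e ^+ 2 * m2); last by ring.
by apply: cvgD; [apply: cvgB|]; apply: cvgM => //; exact: cvg_cst.
Qed.

(** For nonnegative [w] this says that [w] is a probability law with mean [mu] and variance
    [sigma2]. The factor [c] and the remainder [B] carry the contribution of other sites when the
    law is applied one site at a time. *)
Definition quadratic_law (w : nat -> R) (mu sigma2 : R) :=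
  forall c e a B : R, 0 <= c -> 0 <= B ->
    \esum_(n in [set: nat]) (c * w n * ((a - e * n%:R) ^+ 2 + B))%:E =
    (c * (e ^+ 2 * sigma2 + (a - e * mu) ^+ 2 + B))%:E.

(** The first moment converges because [n <= n ^ 2]. The variance is positive because the law
    charges both 0 and 1. *)
Lemma quadratic_law_exists (w : nat -> R) :
  (forall n, 0 < w n) -> series w @ \oo --> (1 : R) ->
  cvgn (series (fun n => w n * n%:R ^+ 2)) ->
  exists mu sigma2 : R, 0 < sigma2 /\ quadratic_law w mu sigma2.
Proof.
move=> w0 c0 c2.
have w0' n : 0 <= w n by exact: ltW.
have c1 : cvgn (series (fun n => w n * n%:R)).
  apply: series_le_cvg c2 => n; rewrite ?mulr_ge0 ?sqr_ge0//.
  rewrite ler_wpM2l// -natrX ler_nat; case: n => // n.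
  by rewrite expnS expn1 leq_pmulr.
set m1 := limn (series (fun n => w n * n%:R)) in c1.
set m2 := limn (series (fun n => w n * n%:R ^+ 2)) in c2.
have cv c e a B := @series_quadratic w m1 m2 c e a B c0 c1 c2.
exists m1, (m2 - m1 ^+ 2); split; last first.
  move=> c e a B c_ge0 B_ge0; apply: esum_series; last exact: cv.
  by move=> n; rewrite !mulr_ge0// addr_ge0// sqr_ge0.
have m1_gt0 : 0 < m1.
  apply: lt_le_trans (@series_ge_partial _ m1 2 _ c1); last first.
    by move=> n; rewrite mulr_ge0.
  by rewrite /series/= !big_nat_recr//= big_geq// mulr0 !add0r mulr1.
(* This series sums to the variance, and its term at 0 is [w 0 * m1 ^ 2], which is positive. *)
have := cv 1 1 m1 0; rewrite !mul1r expr1n mul1r subrr expr0n/= !addr0 => v.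
apply: lt_le_trans (@series_ge_partial _ _ 1 _ v); last first.
  by move=> n; rewrite !mulr_ge0// addr_ge0// sqr_ge0.
rewrite /series/= big_nat1 mulr0 addr0 subr0 mul1r.
by rewrite mulr_gt0// exprn_gt0.
Qed.

Variable beta : R.
Hypothesis beta_gt0 : 0 < beta.

Definition gibbs_weight (n : nat) : R := (Z0 beta)^-1 * expR (- (beta * n%:R)).

Lemma expR_neg_geometric (c : R) :
  (fun n : nat => expR (- (c * n%:R))) = geometric 1 (expR (- c)).
Proof.
by apply/funext => n; rewrite /geometric /= mul1r -expRM_natl mulrN [n%:R * _]mulrC.
Qed.

Lemma is_cvg_series_expR_neg (c : R) : 0 < c ->
  cvgn (series (fun n : nat => expR (- (c * n%:R)))).
Proof.
move=> c0; rewrite expR_neg_geometric; apply: is_cvg_geometric_series.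
by rewrite ger0_norm ?expR_ge0// expR_lt1 oppr_lt0.
Qed.

Lemma Z0_gt0 : 0 < Z0 beta.
Proof.
have := @series_ge_partial _ (Z0 beta) 1 (fun n => expR_ge0 _)
  (is_cvg_series_expR_neg beta_gt0).
by apply: lt_le_trans; rewrite /series/= big_nat1 expR_gt0.
Qed.

Lemma gibbs_weight_gt0 n : 0 < gibbs_weight n.
Proof. by rewrite mulr_gt0 ?expR_gt0// invr_gt0 Z0_gt0. Qed.

Lemma series_gibbs_weight : series gibbs_weight @ \oo --> (1 : R).
Proof.
rewrite (_ : series _ = (fun N =>
  (Z0 beta)^-1 * series (fun n : nat => expR (- (beta * n%:R))) N)); last first.
  by apply/funext => N; rewrite /series/= mulr_sumr.
have h : series (fun n : nat => expR (- (beta * n%:R))) @ \oo --> Z0 beta :=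
  is_cvg_series_expR_neg beta_gt0.
have Z0_neq0 : Z0 beta != 0 by exact: lt0r_neq0 Z0_gt0.
have := cvgM (cvg_cst (Z0 beta)^-1) h; rewrite mulVf//; exact.
Qed.

Lemma is_cvg_gibbs_second_moment :
  cvgn (series (fun n => gibbs_weight n * n%:R ^+ 2)).
Proof.
(* [(1 + beta n / 4)^2 <= exp (beta n / 2)] *)
have b0 : 0 < beta / 2 by rewrite divr_gt0.
have := is_cvg_series_expR_neg b0.
move=> /(@is_cvg_seriesZ _ _ ((Z0 beta)^-1 * (16 / beta ^+ 2))).
apply: series_le_cvg => n.
- by rewrite mulr_ge0 ?sqr_ge0// ltW// gibbs_weight_gt0.
- rewrite mulr_ge0 ?expR_ge0// mulr_ge0//; last by rewrite divr_ge0// sqr_ge0.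
  by rewrite invr_ge0 ltW// Z0_gt0.
(* The Gibbs factor is [E * E]: one [E] absorbs the square, and the other leaves a convergent
   geometric series. The constant [16 / beta ^+ 2] undoes the scaling of [n] by [beta / 4]. *)
pose E := expR (- (beta / 2 * n%:R)).
have E0 : 0 < E by exact: expR_gt0.
have h : (beta * n%:R / 4) ^+ 2 * E <= 1.
  rewrite /E expRN ler_pdivrMr ?expR_gt0// mul1r.
  rewrite (_ : beta / 2 * n%:R = 2%:R * (beta * n%:R / 4)); last by field.
  rewrite expRM_natl lerXn2r ?nnegrE ?expR_ge0//.
    by rewrite divr_ge0// mulr_ge0// ltW.
  by apply: le_trans (expR_ge1Dx _); rewrite lerDr.
rewrite /gibbs_weight (_ : expR (- (beta * n%:R)) = E * E); last first.
  by rewrite -expRD; congr expR; field.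
have b_neq0 : beta != 0 by exact: lt0r_neq0.
rewrite (_ : _ * _ * _ = (Z0 beta)^-1 * (16 / beta ^+ 2) * E *
  ((beta * n%:R / 4) ^+ 2 * E)); last first.
  by field; rewrite b_neq0 lt0r_neq0 ?Z0_gt0.
rewrite -[leRHS]/((Z0 beta)^-1 * (16 / beta ^+ 2) * E) ler_piMr//.
rewrite mulr_ge0 ?(ltW E0)// mulr_ge0//; last by rewrite divr_ge0// sqr_ge0.
by rewrite invr_ge0 ltW// Z0_gt0.
Qed.

End OneSite.

(** * Expectations in the product state *)

Section ProductExpectation.
Variables (R : realType) (d : nat).
Implicit Types (n m : config d) (j : site d).

Definition supported (s : seq (site d)) : set (config d) :=
  [set n | forall j, j \notin s -> n j = 0%N].

Lemma supported_nil : supported [::] = [set [fsfun]].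
Proof.
apply/seteqP; split=> [n n0|_ -> j _]; last by rewrite fsfunE.
by apply/fsfunP => j; rewrite n0// fsfunE.
Qed.

(** The occupation number of [x] is split off, to sum over configurations one site at a time.
    Injectivity holds because the remaining configuration vanishes at [x]. *)
Lemma supported_cons_bij x (s : seq (site d)) : x \notin s ->
  set_bij ([set: nat] `*`` (fun=> supported s)) (supported (x :: s))
    (fun p : nat * config d => [fsfun p.2 with x |-> p.1]).
Proof.
move=> xs; split.
- move=> [k n] /= [_ ns] j; rewrite inE negb_or => /andP[jx js].
  by rewrite fsfun_withE (negbTE jx) ns.
- move=> [k n] [k' n'] /=; rewrite !inE /= => -[_ ns] [_ ns'] e.
  have ev j : [fsfun n with x |-> k] j = [fsfun n' with x |-> k'] j by rewrite e.
  congr pair; first by have := ev x; rewrite !fsfun_with.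
  apply/fsfunP => j; have := ev j; rewrite !fsfun_withE.
  by case: (j =P x) => // -> _; rewrite ns// ns'.
- move=> n ns; exists (n x, [fsfun n with x |-> 0%N]) => /=.
    split=> // j js; rewrite fsfun_withE; case: (j =P x) => // /eqP jx.
    by rewrite ns// inE negb_or jx.
  apply/fsfunP => j; rewrite !fsfun_withE.
  by case: (j =P x) => [->|].
Qed.

(* Summing out one site changes [c], [a] and [B], which are therefore general. *)
Lemma esum_product_quadratic (w : nat -> R) (mu sigma2 : R)
    (phi : site d -> R) (s : seq (site d)) (c a B : R) :
  (forall k, 0 <= w k) -> 0 <= sigma2 -> quadratic_law w mu sigma2 ->
  uniq s -> 0 <= c -> 0 <= B ->
  \esum_(n in supported s) (c * (\prod_(j <- s) w (n j)) *
    ((a - \sum_(j <- s) phi j * (n j)%:R) ^+ 2 + B))%:E =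
  (c * (sigma2 * (\sum_(j <- s) phi j ^+ 2) +
    (a - mu * \sum_(j <- s) phi j) ^+ 2 + B))%:E.
Proof.
move=> w0 s20 wlaw; elim: s c a B => [|x s ih] c a B /= => [_|/andP[xs us]] c0 B0.
  rewrite supported_nil esum_set1 !big_nil.
    by rewrite !mulr0 !subr0 mulr1 add0r.
  by rewrite lee_fin mulr1 subr0 mulr_ge0// addr_ge0// sqr_ge0.
pose F n : R := c * (\prod_(j <- x :: s) w (n j)) *
  ((a - \sum_(j <- x :: s) phi j * (n j)%:R) ^+ 2 + B).
rewrite (reindex_esum _ _ _ _ (supported_cons_bij xs)).
(* Tonelli's theorem for nonnegative terms. *)
rewrite -(@esum_esum _ _ _ [set: nat] (fun=> supported s)
  (fun k n => (F [fsfun n with x |-> k])%:E)); last first.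
  move=> k n _ _; rewrite lee_fin mulr_ge0 ?addr_ge0 ?sqr_ge0//.
  by rewrite mulr_ge0// prodr_ge0.
under eq_esum => k _.
  under eq_esum => n _.
    rewrite /F !big_cons fsfun_with /=.
    rewrite (_ : \prod_(j <- s) _ = \prod_(j <- s) w (n j)); last first.
      apply: eq_big_seq => j js; rewrite fsfun_withE.
      by case: (j =P x) => // e; rewrite -e js in xs.
    rewrite (_ : \sum_(j <- s) _ = \sum_(j <- s) phi j * (n j)%:R); last first.
      apply: eq_big_seq => j js; rewrite fsfun_withE.
      by case: (j =P x) => // e; rewrite -e js in xs.
    rewrite mulrA opprD addrA.
    over.
  rewrite ih// ?mulr_ge0//.
  (* As a function of the occupation [k] of [x] this is again quadratic: the mean of the other sites
     shifts [a], and their variance is added to [B]. *)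
  rewrite (_ : c * w k * _ = c * w k *
    (((a - mu * \sum_(j <- s) phi j) - phi x * k%:R) ^+ 2 + (sigma2 * (\sum_(j <- s) phi j ^+ 2) + B))); last by ring.
  over.
rewrite wlaw//; last first.
  by rewrite addr_ge0// mulr_ge0// sumr_ge0// => ? _; exact: sqr_ge0.
by rewrite !big_cons; congr (_%:E); ring.
Qed.

End ProductExpectation.

(** * Unconditional sums of nonnegative reals inside the complex numbers *)

Section ComplexSum.
Variable R : realType.

(** The extended sum is the supremum of the finite partial sums. A finite set that comes within [e]
    of it works as threshold, since larger sets have partial sums between that one and [l]. *)
Lemma cvg_partial_sum_complex (T : choiceType) (x : T -> R) (l : R) :
  (forall i, 0 <= x i) -> \esum_(i in [set: T]) (x i)%:E = l%:E ->
  partial_sum (fun i => (x i)%:C : R[i]^o) @ totally --> (l%:C : R[i]^o).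
Proof.
move=> x0 xl.
apply/(@cvgrPdist_lt R[i] R[i]^o) => e e0.
(* A positive element of [R[i]] is real. *)
have [Re0 Ie0] : 0 < complex.Re e /\ complex.Im e = 0.
  by move: e0; case: e => u v; rewrite ltcE /= => /andP[/eqP ->].
have ub (A : {fset T}) : \sum_(i <- A) x i <= l.
  rewrite -lee_fin -xl; apply: esum_ge; exists [set` A].
    by split => //; exact: finite_fset.
  by rewrite fsbig_finite ?finite_fset// set_fsetK sumEFin.
have [_ [X [finX _] <-]] : exists2 y,
    [set \sum_(i \in A) (x i)%:E | A in fsets setT]%E y &
    (l%:E - (complex.Re e)%:E < y)%E.
  by apply: ereal_sup_gt; rewrite -/(esum _ _) xl lte_fin ltrBlDr ltrDl.
rewrite fsbig_finite//= sumEFin lte_fin => lX.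
exists (fset_set X) => // A /= XA.
rewrite partial_sumE -rmorph_sum -rmorphB /=.
have -> : e = (complex.Re e)%:C by case: (e) Ie0 => u v /= ->.
rewrite normc_def /= expr0n /= addr0 sqrtr_sqr ltcR ger0_norm; last first.
  by rewrite subr_ge0.
rewrite ltrBlDl -ltrBlDr; apply: lt_le_trans lX _.
rewrite [leRHS](big_fsetID _ [in fset_set X])/=.
rewrite (_ : [fset _ | _ in A & _]%fset = fset_set X); last first.
  apply/fsetP => i; rewrite !inE /=; apply/andP/idP => [[]//|iX].
  by split => //; exact: (fsubsetP XA).
by rewrite lerDl sumr_ge0.
Qed.

Lemma sum_real_complex (T : choiceType) (x : T -> R) (l : R) :
  (forall i, 0 <= x i) -> \esum_(i in [set: T]) (x i)%:E = l%:E ->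
  sum (fun i => (x i)%:C : R[i]^o) = l%:C.
Proof.
move=> x0 xl; apply: (@cvg_lim R[i]^o); first exact: norm_hausdorff.
exact: cvg_partial_sum_complex.
Qed.

End ComplexSum.

(** * Variance of the number operator *)

Section NumberVariance.
Variables (R : realType) (d : nat) (beta : R).
Hypothesis beta_gt0 : 0 < beta.
Implicit Types (n : config d) (Lam L : {fset site d}).

Lemma thermolim_near_cst (u : {fset site d} -> R[i]) (l : R[i]) L0 :
  (forall L, (L0 `<=` L)%fset -> u L = l) -> thermolim u = l.
Proof.
move=> ul; apply: (@lim_near_cst R[i]^o); first exact: norm_hausdorff.
by exists L0 => // L /= /ul ->.
Qed.

Lemma big_fset_indicator Lam L (F : site d -> R) : (Lam `<=` L)%fset ->
  \sum_(j <- L) (j \in Lam)%:R * F j = \sum_(j <- Lam) F j.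
Proof.
move=> sub; rewrite -(big_fset_incl _ sub)/= => [|j _ /negbTE ->]; last first.
  by rewrite mul0r.
by apply: eq_big_seq => j ->; rewrite mul1r.
Qed.

Lemma weight_ge0 L n : 0 <= weight beta L n.
Proof. by apply: prodr_ge0 => j _; rewrite ltW// gibbs_weight_gt0. Qed.

(** All factors are diagonal, so the two square roots of the density recombine into the weight and
    [F] enters through its squared modulus. The sum is put in real form for [sum_real_complex]. *)
Lemma trace_cdiagop_sq L (F : config d -> R[i]) :
  trace L (mulop (rho beta 2^-1 L) (mulop (adjop (cdiagop F))
    (mulop (rho beta 2^-1 L) (cdiagop F)))) =
  sum (fun n => (if (finsupp n `<=` L)%fset then
    weight beta L n * (complex.Re (F n) ^+ 2 + complex.Im (F n) ^+ 2)
    else 0)%:C : R[i]^o).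
Proof.
rewrite /trace; apply: (congr1 (fun v : config d -> (R[i])^o => sum v)).
apply/funext => n; case: ifP => // _.
have adjE : adjop (cdiagop F) = cdiagop (fun n => (F n)^*).
  apply/funext => p; apply/funext => q; rewrite /adjop /cdiagop eq_sym.
  by case: (p =P q) => [->//|_]; rewrite rmorph0.
rewrite adjE /rho diagopE !mul_diagop /cdiagop eqxx.
have w2 : (weight beta L n `^ 2^-1) * (weight beta L n `^ 2^-1) = weight beta L n.
  by rewrite -expr2 powR12_sqrt ?weight_ge0// sqr_sqrtr ?weight_ge0.
rewrite -[in RHS]w2; case: (F n) => u v.
by apply/eqP; rewrite eq_complex /=; apply/andP; split; apply/eqP; ring.
Qed.

(** The product formula is applied on [L] with the indicator of [Lam] as coefficients, so sites
    outside [Lam] contribute nothing and the value is the same for every such [L]. The real part of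
    the scalar is the bias [a]; its imaginary part gives the remainder [b ^+ 2]. *)
Lemma trace_numop_sq mu sigma2 Lam L (a b : R) : 0 <= sigma2 ->
  quadratic_law (gibbs_weight beta) mu sigma2 -> (Lam `<=` L)%fset ->
  let F n := (occ Lam n)%:R - Complex a b in
  trace L (mulop (rho beta 2^-1 L) (mulop (adjop (cdiagop F))
    (mulop (rho beta 2^-1 L) (cdiagop F)))) =
  (sigma2 * #|` Lam|%:R + (a - mu * #|` Lam|%:R) ^+ 2 + b ^+ 2)%:C.
Proof.
move=> s20 wlaw sub F; rewrite trace_cdiagop_sq; apply: sum_real_complex => [n|].
  by case: ifP => // _; rewrite mulr_ge0 ?weight_ge0// addr_ge0 ?sqr_ge0.
have FE n : complex.Re (F n) ^+ 2 + complex.Im (F n) ^+ 2 =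
    (a - \sum_(j <- L) (j \in Lam)%:R * (n j)%:R) ^+ 2 + b ^+ 2.
  rewrite big_fset_indicator// -natr_sum -/(occ Lam n).
  rewrite /F -(rmorph_nat (real_complex R)) /= add0r sqrrN; congr (_ + _).
  by rewrite -sqrrN opprB.
have sum1 : \sum_(j <- L) (j \in Lam)%:R = #|` Lam|%:R :> R.
  have := big_fset_indicator (fun=> 1) sub.
  under eq_bigr do rewrite mulr1.
  by move=> ->; rewrite big_const_seq count_predT iter_addr_0.
have := @esum_product_quadratic R d (gibbs_weight beta) mu sigma2
  (fun j => (j \in Lam)%:R) L 1 a (b ^+ 2)
  (fun k => ltW (gibbs_weight_gt0 beta_gt0 k)) s20 wlaw
  (fset_uniq L) ler01 (sqr_ge0 b).
rewrite sum1 (eq_bigr (fun j => (j \in Lam)%:R)); last first.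
  by move=> j _; case: (j \in Lam); rewrite ?expr1n ?expr0n.
rewrite sum1 mul1r => <-; rewrite [RHS]esum_mkcond; apply: eq_esum => n _.
have -> : (n \in supported L) = (finsupp n `<=` L)%fset.
  apply/idP/fsubsetP => [|nL]; rewrite inE.
    move=> nL j; rewrite mem_finsupp; apply: contraNT => /nL ->; exact: eqxx.
  by move=> j; apply: contraNeq => nj; apply: nL; rewrite mem_finsupp.
by case: ifP => // _; rewrite FE mul1r.
Qed.

(** Dropping the squared bias and the imaginary part leaves the variance. As [s] is arbitrary, the
    bound covers the centred observable whatever value [stateL2] takes. *)
Lemma norm2_numop_sub mu sigma2 Lam (s : R[i]) : 0 <= sigma2 ->
  quadratic_law (gibbs_weight beta) mu sigma2 ->
  sigma2 * #|` Lam|%:R <= norm2 beta (numop R Lam + (- s) *: oneop) ^+ 2.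
Proof.
case: s => a b s20 wlaw; rewrite /norm2 /inner2.
have -> : numop R Lam + (- Complex a b) *: oneop =
    cdiagop (fun n => (occ Lam n)%:R - Complex a b).
  apply/funext => n; apply/funext => m; rewrite numopE /oneop diagopE.
  rewrite -[LHS]/(cdiagop _ n m + - Complex a b * cdiagop _ n m) /cdiagop.
  by case: (n =P m) => [_|_]; rewrite ?mulr1// mulr0 addr0.
rewrite (@thermolim_near_cst _
  (sigma2 * #|` Lam|%:R + (a - mu * #|` Lam|%:R) ^+ 2 + b ^+ 2)%:C Lam); last first.
  by move=> L sub; exact: trace_numop_sq.
rewrite sqr_sqrtr/=; first by rewrite -addrA lerDl addr_ge0 ?sqr_ge0.
by rewrite !addr_ge0 ?sqr_ge0// mulr_ge0.
Qed.

Lemma norm2_0 : norm2 beta (0 : op R d) = 0.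
Proof.
have mulop0 (X : op R d) : mulop X 0 = 0.
  apply/funext => n; apply/funext => m; rewrite /mulop fsbig1// => k _.
  by rewrite -[(0 : op R d) k m]/0 mulr0.
rewrite /norm2 /inner2 (@thermolim_near_cst _ 0 fset0) ?sqrtr0// => L _.
rewrite !mulop0 /trace (_ : (fun n => _) = fun n => (0 : R)%:C); last first.
  by apply/funext => n; case: ifP.
by apply: (@sum_real_complex R) => // ; rewrite esum1.
Qed.

End NumberVariance.

(** * Cubes *)

Section Boxes.
Variable d : nat.

Definition box_site L (x : 'rV['I_(2 * L).+1]_d) : site d :=
  \row_t ((x 0 t : nat)%:Z - L%:Z).

Definition box (L : nat) : {fset site d} :=
  [fset box_site x | x in {: 'rV['I_(2 * L).+1]_d}]%fset.

Lemma mem_box L (x : site d) :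
  reflect (forall t, `|x 0 t| <= L%:Z) (x \in box L).
Proof.
apply: (iffP (imfsetP _ _ _ _)) => /= [[y _ -> t]|xL].
  rewrite mxE; have := ltn_ord (y 0 t); rewrite ltnS => h.
  by rewrite ler_norml; apply/andP; split; lia.
exists (\row_t (inord `|(x 0 t + L%:Z)%R|%N : 'I_(2 * L).+1)) => //.
apply/rowP => t; rewrite !mxE; have := xL t; rewrite ler_norml => /andP[h1 h2].
by rewrite inordK; lia.
Qed.

Lemma card_box L : #|` box L| = ((2 * L).+1 ^ d)%N.
Proof.
rewrite card_imfset /=; last first.
  move=> x y /rowP e; apply/rowP => t; apply/val_inj.
  by have := e t; rewrite !mxE => /addIr [].
by rewrite -cardE card_mx card_ord mul1n.
Qed.

Lemma box_subset L L' : (L <= L')%N -> (box L `<=` box L')%fset.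
Proof.
move=> LL'; apply/fsubsetP => x /mem_box xL; apply/mem_box => t.
by apply: le_trans (xL t) _; rewrite lez_nat.
Qed.

Lemma subset_box (s : {fset site d}) : exists c, (s `<=` box c)%fset.
Proof.
exists (\max_(x <- s) \max_t `|x 0%R t|)%N; apply/fsubsetP => x xs.
apply/mem_box => t; rewrite -abszE lez_nat.
apply: leq_trans (leq_bigmax_seq x xs isT).
exact: (@leq_bigmax _ (fun t => `|x 0%R t|%N)).
Qed.

Lemma box_add L c (x k : site d) :
  x \in box c -> k \in box L -> x + k \in box (L + c).
Proof.
move=> /mem_box xc /mem_box kL; apply/mem_box => t; rewrite mxE.
by rewrite PoszD addrC (le_trans (ler_normD _ _))// lerD.
Qed.

Lemma box_add_inv L c (x k : site d) :
  x \in box c -> x + k \in box L -> k \in box (L + c).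
Proof.
move=> /mem_box xc xkL; rewrite -[k](addKr x).
by apply: box_add => //; apply/mem_box => t; rewrite mxE normrN.
Qed.

End Boxes.

(** The ratio of the volumes of the two cubes is the [d]-th power of the ratio of their sides, which
    tends to 1. *)
Lemma box_boundary_negligible (R : realType) (d c : nat) (e C : R) : 0 < e ->
  exists M : nat, C * (((2 * (M + c)).+1 ^ d)%:R - ((2 * M).+1 ^ d)%:R)
    < e * ((2 * M).+1 ^ d)%:R.
Proof.
(* With [harmonic n] equal to [1 / (n + 1)], the value of [y] at [2 * M] is the ratio of the
   sides. *)
move=> e0; pose y (n : nat) : R := 1 + (2 * c)%:R * harmonic n.
have y1 : y @ \oo --> (1 : R).
  rewrite -[X in _ --> X]addr0 -[X in _ --> _ + X](mulr0 (2 * c)%:R).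
  by apply: cvgD; [exact: cvg_cst|apply: cvgM; [exact: cvg_cst|exact: cvg_harmonic]].
have yd : (fun n => C * (y n ^+ d - 1)) @ \oo --> (0 : R).
  suff : (fun n => C * (y n ^+ d - 1)) @ \oo --> C * (1 ^+ d - 1).
    by rewrite expr1n subrr mulr0.
  apply: cvgM; first exact: cvg_cst.
  apply: cvgB; last exact: cvg_cst.
  exact: (cvg_comp _ _ y1 (@exprn_continuous R d 1)).
(* The threshold itself serves as [M], because [y] is evaluated at [2 * N], which is at least
   [N]. *)
have [N _ hN] := cvgr_lt _ yd _ e0; exists N.
have n0 : (2 * N).+1%:R != 0 :> R by rewrite pnatr_eq0.
have yE : (2 * (N + c)).+1%:R / (2 * N).+1%:R = y (2 * N)%N.
  by rewrite /y /harmonic/= mulnDr -addSn natrD mulrDl mulfV.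
rewrite !natrX -ltr_pdivrMr ?exprn_gt0// -mulrA mulrBl mulfV ?expf_neq0//.
by rewrite -expr_div_n yE; apply: hN => /=; rewrite leq_pmull.
Qed.

(** * Local polynomials as elements of the completion *)

Section ConstantSequences.
Variables (R : realType) (d : nat) (beta : R).
Implicit Types (X f : op R d).

Lemma const_cauchy f (e : R) : 0 < e -> exists N : nat, forall p q : nat,
  (N <= p)%N -> (N <= q)%N -> norm2 beta (f - f) < e.
Proof. by move=> e0; exists 0%N => p q _ _; rewrite subrr norm2_0. Qed.

Definition constL2 f (lf : local_poly f) : L2 d beta :=
  @MkL2 R d beta (fun=> f) (fun=> lf) (const_cauchy f).

Lemma normL2_eq_cst (f : L2 d beta) (l : R) :
  (forall n, norm2 beta (f n) = l) -> normL2 f = l.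
Proof.
move=> fl; rewrite /normL2 (_ : (fun n => _) = fun=> l); last exact/funext.
by rewrite (cvg_lim _ (cvg_cst l)).
Qed.

(** The constant sequence at [delta X f] lies in the graph, so its norm is a candidate in the
    infimum. *)
Lemma delta_norm_sq_const X f (lf : local_poly f) : local_poly X ->
  (delta_norm_sq X (constL2 lf) <= (norm2 beta (delta X f) ^+ 2)%:E)%E.
Proof.
move=> lX; apply: ereal_inf_lbound.
exists (constL2 (local_poly_delta lX lf)); last first.
  by rewrite (@normL2_eq_cst _ (norm2 beta (delta X f))).
exists (constL2 lf); rewrite /eqL2 /=.
by split; rewrite subrr norm2_0; exact: cvg_cst.
Qed.

End ConstantSequences.

(** * The Dirichlet form of the number operator *)

Section DirichletNumop.
Variables (R : realType) (d : nat) (beta : R).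
Implicit Types (I J Lam : {fset site d}) (k : site d).

Lemma size_translate I k : size (translate I k) = size I.
Proof.
have [s sI ->] := translate_perm k I.
by rewrite size_map; apply: perm_size; rewrite -mem_permutations.
Qed.

Lemma count_translate_in Lam I k :
  (forall j, j \in I -> j + k \in Lam) -> count [in Lam] (translate I k) = size I.
Proof.
move=> sub; rewrite -(size_translate I k); apply/eqP; rewrite -all_count.
by apply/allP => j; rewrite mem_translate => /sub; rewrite /= subrK.
Qed.

Lemma count_translate_out Lam I k :
  (forall j, j \in I -> j + k \notin Lam) -> count [in Lam] (translate I k) = 0%N.
Proof.
move=> sub; apply/eqP; rewrite -leqn0 leqNgt -has_count -all_predC.
by apply/allP => j; rewrite mem_translate => /sub; rewrite /= subrK.
Qed.


(** For [k] within radius [M] both translates lie in the cube of radius [M + c], and for [k] beyond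
    [M + c + c] both lie outside. The two counts then agree, so the commutator vanishes; only the
    shell in between costs [C]. *)
Lemma delta_norm_sq_numop_le I J (C : R) c M k :
  #|` I| = #|` J| -> (I `|` J `<=` box d c)%fset -> 0 <= C ->
  (forall (a b : nat), (a <= #|` I|)%N -> (b <= #|` I|)%N ->
    norm2 beta (('i * (a%:R - b%:R)) *: prodA R (translate I k) (translate J k)) ^+ 2
      <= C) ->
  (delta_norm_sq (prodA R (translate I k) (translate J k))
     (constL2 beta (local_poly_numop R (box d (M + c)))) <=
   (if k \in (box d (M + c + c) `\` box d M)%fset then C else 0)%:E)%E.
Proof.
move=> cardIJ sub C0 hC.
have inI j : j \in I -> j \in box d c.
  by move=> jI; apply: (fsubsetP sub); rewrite inE jI.
have inJ j : j \in J -> j \in box d c.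
  by move=> jJ; apply: (fsubsetP sub); rewrite inE jJ orbT.
apply: le_trans (@delta_norm_sq_const R d beta _ _ _ (local_poly_prodA _ _ _)) _.
rewrite (delta_numop (@shifts_occ_prodA R d (box d (M + c)) _ _)) lee_fin.
have norm0 a : norm2 beta (('i * (a%:R - a%:R)) *:
    prodA R (translate I k) (translate J k)) ^+ 2 = 0.
  by rewrite subrr mulr0 scale0r norm2_0 expr0n.
rewrite in_fsetD; have [kM|kM] /= := boolP (k \in box d M).
  have -> : count [in box d (M + c)] (translate I k) = #|` I|.
    by apply: count_translate_in => j /inI jc; exact: box_add.
  have -> : count [in box d (M + c)] (translate J k) = #|` I|.
    by rewrite cardIJ; apply: count_translate_in => j /inJ jc; exact: box_add.
  by rewrite norm0.
have [kMc|kMc] := boolP (k \in box d (M + c + c)).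
  apply: hC; rewrite (leq_trans (count_size _ _))// size_translate//.
  by rewrite cardIJ.
have -> : count [in box d (M + c)] (translate I k) = 0%N.
  apply: count_translate_out => j /inI jc; apply: contra kMc; exact: box_add_inv.
have -> : count [in box d (M + c)] (translate J k) = 0%N.
  apply: count_translate_out => j /inJ jc; apply: contra kMc; exact: box_add_inv.
by rewrite norm0.
Qed.

(** Both constants are chosen before [M], so the bound follows the size of a shell of fixed
    thickness as the cube grows. *)
Lemma dirichlet_numop_le I J : #|` I| = #|` J| ->
  exists C : R, exists c : nat, forall M : nat,
  (dirichlet I J (constL2 beta (local_poly_numop R (box d (M + c)))) <=
   (C * (#|` box d (M + c + c)|%:R - #|` box d M|%:R))%:E)%E.
Proof.
move=> cardIJ; have [c sub] := subset_box (I `|` J)%fset.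
have [C [C0 hC]] := norm2_commutator_bounded beta I J #|` I|.
exists C, c => M.
pose B := (box d (M + c + c) `\` box d M)%fset.
apply: (@le_trans _ _ (\esum_(k in [set: site d]) (if k \in B then C else 0)%:E)).
  by apply: le_esum => k _; apply: delta_norm_sq_numop_le => // a b; exact: hC.
rewrite (_ : \esum_(k in _) _ = \esum_(k in [set` B]) C%:E); last first.
  by rewrite [RHS]esum_mkcond; apply: eq_esum => k _; rewrite mem_setE; case: ifP.
rewrite esum_fset ?finite_fset// fsbig_finite ?finite_fset//= set_fsetK sumEFin.
rewrite big_const_seq count_predT iter_addr_0 -[size B]/#|` B|.
have Msub : (box d M `<=` box d (M + c + c))%fset.
  by apply: box_subset; rewrite -addnA leq_addr.
by rewrite cardfsDS// -[C *+ _]mulr_natr natrB// fsubset_leq_card.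
Qed.

End DirichletNumop.

(** * Contradiction between volume and boundary growth *)

Unset Implicit Arguments.
Local Open Scope fset_scope.

Theorem theorem3p11 (R : realType) (d : nat) (beta : R) (hbeta : 0 < beta)
    (I J : {fset 'rV[int]_d}) (hcard : #|` I| = #|` J|)
    (hdisj : I `&` J = fset0) :
  ~ exists m : R, 0 < m /\
      forall f : L2 d beta, (dirichlet I J f < +oo)%E ->
        ((m * normL2 (centered f) ^+ 2)%:E <= dirichlet I J f)%E.
Proof.
move=> [m [m0 poincare]].
have [mu [sigma2 [s20 law]]] := quadratic_law_exists (gibbs_weight_gt0 hbeta)
  (series_gibbs_weight hbeta) (is_cvg_gibbs_second_moment hbeta).
have [C [c dirichlet_le]] := dirichlet_numop_le beta hcard.
(* The shell has thickness [c + c], and [m * sigma2] is the density that the supposed inequality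
   would force on the form. The rest proves the reverse inequality for this [M]. *)
have [M] := box_boundary_negligible d (c + c) C (mulr_gt0 m0 s20).
rewrite -!card_box addnA; apply/negP; rewrite -leNgt.
have finite_form := le_lt_trans (dirichlet_le M) (ltry _).
have := le_trans (poincare _ finite_form) (dirichlet_le M); rewrite lee_fin.
apply: le_trans; rewrite -mulrA ler_pM2l//.
(* Centring a constant sequence gives a constant sequence, so its norm is that of the term at 0. *)
rewrite (@normL2_eq_cst _ _ _ _ (norm2 beta (center_seq (constL2 beta
  (local_poly_numop R (box d (M + c)))) 0)))//.
(* The variance is proportional to the volume of the cube of radius [M + c], which contains the one
   of radius [M]. *)
apply: le_trans (norm2_numop_sub hbeta _ _ (ltW s20) law).
rewrite ler_pM2l// ler_nat; apply: fsubset_leq_card.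
by apply: box_subset; rewrite leq_addr.
Qed.
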